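(* Let $y\in\mathbb{R}^n$ be a random data vector with distribution $\mathcal{P}_y$. For every selection $S\in\mathcal{S}$ let $\beta_S$ be a fixed (non-random) inferential target, and for every $S\in\mathcal S$ and every level $\alpha\in(0,1)$ let $\mathrm{CI}_S^{(\alpha)}$ be a confidence region computed from $y$ such that, for each fixed $S$, $\mathbb{P}\{\beta_S\notin \mathrm{CI}_S^{(\alpha)}\}\le \alpha$. Fix $\delta\in(0,1)$ and let $\hat S:\mathbb{R}^n\to\mathcal{S}$ be an $(\eta,\tau,\nu)$-stable selection algorithm (with respect to $\mathcal{P}_y$). Then, writing $\hat S=\hat S(y)$, $$\mathbb{P}\left\{\beta_{\hat S}\notin \mathrm{CI}_{\hat S}^{(\delta e^{-\eta})}\right\}\le \delta+\tau+\nu .$$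
   Context: A random variable $Q$ is $(\eta,\tau)$-indistinguishable from $W$, written $Q\approx_{\eta,\tau}W$, if $\mathbb{P}\{Q\in\mathcal{O}\}\le e^{\eta}\mathbb{P}\{W\in\mathcal{O}\}+\tau$ for all measurable sets $\mathcal{O}$. A randomized algorithm $\mathcal{A}:\mathbb{R}^n\to\mathcal{S}$ (whose internal randomness is independent of the data) is $(\eta,\tau,\nu)$-stable with respect to a distribution $\mathcal{P}$ on $\mathbb{R}^n$ if there exists a random variable $A_0$ (the oracle), whose law may depend on $\mathcal{P}$ but which is independent of the data, such that $\mathcal{P}\{\omega\in\mathbb{R}^n:\mathcal{A}(\omega)\approx_{\eta,\tau}A_0\}\ge 1-\nu$. A selection algorithm is a possibly randomized map from the data to a selection; $\hat S$ denotes both the map and its output $\hat S(y)$. All sets and events involved are assumed measurable. *)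

(* Defs.v *)
From HB Require Import structures.
From mathcomp Require Import all_boot all_order all_algebra.
From mathcomp Require Import all_classical all_reals all_analysis.

Set Implicit Arguments.
Unset Strict Implicit.
Unset Printing Implicit Defensive.

Import Order.TTheory GRing.Theory Num.Theory.

Local Open Scope classical_set_scope.
Local Open Scope ring_scope.
Local Open Scope ereal_scope.

Definition independent_rv (R : realType) (d d1 d2 : measure_display)
    (Omega : measurableType d) (P : probability Omega R)
    (T1 : measurableType d1) (T2 : measurableType d2)
    (X : Omega -> T1) (Y : Omega -> T2) : Prop :=
  forall (B1 : set T1) (B2 : set T2), measurable B1 -> measurable B2 ->
    P (X @^-1` B1 `&` Y @^-1` B2) = P (X @^-1` B1) * P (Y @^-1` B2).

(* [Q] and [W] may live on different probability spaces: only their laws are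
   compared. *)
Definition indistinguishable (R : realType) (d1 d2 dS : measure_display)
    (Omega1 : measurableType d1) (P1 : probability Omega1 R)
    (Omega2 : measurableType d2) (P2 : probability Omega2 R)
    (Sel : measurableType dS) (eta tau : R)
    (Q : Omega1 -> Sel) (W : Omega2 -> Sel) : Prop :=
  forall O : set Sel, measurable O ->
    P1 (Q @^-1` O) <= (expR eta)%:E * P2 (W @^-1` O) + tau%:E.

(* A randomized algorithm is a map [A] of the data and of an internal random
   seed [U]; on a fixed data point [x] its output is the random variable
   [fun w => A (x, U w)].  The oracle [A0] is independent of a data vector [Y]
   with law [Py]; the pair [(Y, A0)] is realised on a probability space of its
   own, since only the law of [A0] matters and the space carrying the data need
   not be rich enough to carry an independent [A0].  The set of good data points
   is required to be measurable, so that its probability makes sense. *)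
Definition stable (R : realType) (n : nat) (d dU dS : measure_display)
    (Omega : measurableType d) (P : probability Omega R)
    (Seed : measurableType dU) (U : {RV P >-> Seed})
    (Sel : measurableType dS) (A : {mfun (n.-tuple R * Seed)%type >-> Sel})
    (Py : probability (n.-tuple R) R) (eta tau nu : R) : Prop :=
  exists (d0 : measure_display) (Omega0 : measurableType d0)
    (P0 : probability Omega0 R)
    (Y : {RV P0 >-> n.-tuple R}) (A0 : {RV P0 >-> Sel}),
    let good := [set x : n.-tuple R |
      indistinguishable P P0 eta tau (fun w => A (x, U w)) A0] in
    [/\ forall B : set (n.-tuple R), measurable B ->
          distribution P0 Y B = Py B,
        independent_rv P0 Y A0,
        measurable good &
        (1 - nu)%:E <= Py good].

(* Main.v *)
(* Let [B] be the set of pairs (data, selection) whose region misses the target.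
   As the seed is independent of the data, the error probability is the mean over
   the data point x of P(Shat(x, U) is in the section B_x).  For good x
   this is at most [e^eta P(A0 in B_x) + tau], and bad points have mass at most
   [nu].  The mean of [P(A0 in B_x)] is the product mass of [B]; integrating in
   the other order, over the fixed values S of [A0], validity bounds it by the
   level [delta e^-eta]. *)

Require Import Defs.
From HB Require Import structures.
From mathcomp Require Import all_boot all_order all_algebra.
From mathcomp Require Import all_classical all_reals all_analysis.
From mathcomp Require Import measurable_realfun lra.

Set Implicit Arguments.
Unset Strict Implicit.
Unset Printing Implicit Defensive.

Import Order.TTheory GRing.Theory Num.Theory.

Local Open Scope classical_set_scope.
Local Open Scope ring_scope.
Local Open Scope ereal_scope.

(** The law of the pair and the product of the laws agree on rectangles, and rectangles determine a
    probability on the product. *)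
Lemma independent_rv_pair (R : realType) (d d1 d2 : measure_display)
    (Omega : measurableType d) (P : probability Omega R)
    (T1 : measurableType d1) (T2 : measurableType d2)
    (X : {RV P >-> T1}) (Y : {RV P >-> T2}) (B : set (T1 * T2)) :
  independent_rv P X Y -> measurable B ->
  P [set w | B (X w, Y w)] = (distribution P X \x distribution P Y) B.
Proof.
move=> XY mB.
have mXY : measurable_fun [set: Omega] (fun w => (X w, Y w)).
  exact: measurable_fun_pair.
pose XYm : {mfun Omega >-> (T1 * T2)%type} := mfun_Sub (mem_set mXY).
rewrite (@product_measure_unique _ _ _ _ _ (distribution P X)
  (distribution P Y) (distribution P XYm)); first by [].
- exact: XY.
- exact: mB.
Qed.

(** Since [\x] integrates x-sections, it is first exchanged for [\x^], which integrates y-sections;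
    averaging then preserves the bound because [m2] has mass one. *)
Lemma product_measure_le_ysection (R : realType) (d1 d2 : measure_display)
    (T1 : measurableType d1) (T2 : measurableType d2)
    (m1 : probability T1 R) (m2 : probability T2 R)
    (B : set (T1 * T2)) (c : R) :
  measurable B -> (forall t, m1 (ysection B t) <= c%:E) ->
  (m1 \x m2) B <= c%:E.
Proof.
move=> mB Bc.
have c0 : 0 <= c%:E by exact: le_trans (Bc point).
rewrite (@product_measure_unique _ _ _ _ _ m1 m2 (m1 \x^ m2)) //; last first.
  by move=> A1 A2 mA1 mA2; exact: product_measure2E.
rewrite -[leRHS]mule1 -(@probability_setT _ _ _ m2) -integral_cst//.
apply: ge0_le_integral => //.
- exact: measurable_fun_ysection.
- by move=> t _; exact: Bc.
Qed.

Lemma product_measure_le_xsection (R : realType) (d1 d2 d0 : measure_display)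
    (T1 : measurableType d1) (T2 : measurableType d2) (T0 : measurableType d0)
    (m1 : probability T1 R) (m2 : probability T2 R) (m0 : probability T0 R)
    (C : set (T1 * T2)) (B : set (T1 * T0)) (G : set T1) (k tau nu : R) :
  measurable C -> measurable B -> measurable G ->
  (0 <= k)%R -> (0 <= tau)%R ->
  (forall x, G x -> m2 (xsection C x) <= k%:E * m0 (xsection B x) + tau%:E) ->
  (1 - nu)%:E <= m1 G ->
  (m1 \x m2) C <= k%:E * (m1 \x m0) B + tau%:E + nu%:E.
Proof.
move=> mC mB mG k0 tau0 GCB nuG.
have mxB : measurable_fun [set: T1] (fun x => m0 (xsection B x) : \bar R).
  exact: measurable_fun_xsection.
have mkB : measurable_fun [set: T1] (fun x => k%:E * m0 (xsection B x) : \bar R).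
  exact: measurable_funeM.
have mI : measurable_fun [set: T1] (fun x => (\1_(~` G) x)%:E : \bar R).
  by apply/measurable_EFinP/measurable_indic; exact: measurableC.
have kB0 x : 0 <= k%:E * m0 (xsection B x) by rewrite mule_ge0.
have mkBt : measurable_fun [set: T1]
    (fun x => k%:E * m0 (xsection B x) + tau%:E : \bar R).
  exact: emeasurable_funD.
have GC_nu : m1 (~` G) <= nu%:E.
  rewrite probability_setC// leeBlDr ?fin_num_measure//.
  by rewrite -leeBlDl// -EFinB.
(* The majorant is valid at every [x]: on [G] by [GCB], off [G] because the indicator alone
   dominates a probability. The indicator integrates to at most [nu]. *)
apply: (@le_trans _ _
  (\int[m1]_x (k%:E * m0 (xsection B x) + tau%:E + (\1_(~` G) x)%:E))).
  apply: ge0_le_integral => //=.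
  - exact: measurable_fun_xsection.
  - exact: emeasurable_funD.
  - move=> x _; have [Gx|nGx] := pselect (G x).
      by rewrite (le_trans (GCB x Gx))// leeDl.
    rewrite indicE mem_set//.
    apply: (@le_trans _ _ 1).
      by apply: probability_le1; exact: measurable_xsection.
    by rewrite leeDr// adde_ge0.
rewrite ge0_integralD//=; last by move=> x _; rewrite adde_ge0.
rewrite ge0_integralD//= ge0_integralZl//=.
rewrite -[\int[m1]_x tau%:E]/(\int[m1]_x cst tau%:E x) integral_cst//.
rewrite [X in _ + _ * X + _](probability_setT m1) mule1.
rewrite integral_indic ?setIT//; last exact: measurableC.
by rewrite leeD2l.
Qed.

Theorem theorem2 (R : realType) (n : nat) (d dU dS : measure_display)
    (Omega : measurableType d) (P : probability Omega R)
    (* the data and the internal randomness of the selection *)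
    (y : {RV P >-> n.-tuple R})
    (Seed : measurableType dU) (U : {RV P >-> Seed})
    (yU_indep : independent_rv P y U)
    (* targets (the type of the target may depend on the selection) and
       confidence regions *)
    (Sel : measurableType dS)
    (Target : Sel -> Type) (beta : forall S : Sel, Target S)
    (CI : forall S : Sel, R -> n.-tuple R -> set (Target S))
    (CI_measurable : forall alpha : R,
      measurable [set xS : (n.-tuple R * Sel)%type |
        ~ CI xS.2 alpha xS.1 (beta xS.2)])
    (CI_valid : forall (S : Sel) (alpha : R), (0 < alpha < 1)%R ->
      P [set w | ~ CI S alpha (y w) (beta S)] <= alpha%:E)
    (delta eta tau nu : R) (delta01 : (0 < delta < 1)%R) (tau_ge0 : (0 <= tau)%R)
    (* the stable selection algorithm *)
    (Shat : {mfun (n.-tuple R * Seed)%type >-> Sel})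
    (Shat_stable : stable U Shat (distribution P y) eta tau nu) :
  P [set w | let S := Shat (y w, U w) in
             ~ CI S (delta * expR (- eta))%R (y w) (beta S)]
    <= (delta + tau + nu)%:E.
Proof.
have /andP[d0 d1] := delta01.
have [e0 [T0 [P0 [Y [A0 [_ _ mG nuG]]]]]] := Shat_stable.
set G := (X in measurable X) in mG.
pose alpha := (delta * expR (- eta))%R.
pose B := [set xS : n.-tuple R * Sel | ~ CI xS.2 alpha xS.1 (beta xS.2)].
have mB : measurable B by exact: CI_measurable.
pose C := [set xu : n.-tuple R * Seed | B (xu.1, Shat xu)].
have mC : measurable C.
  (* [C] is the preimage of [B] under the map sending [xu] to [(xu.1, Shat xu)]. *)
  by rewrite -[C]setTI; apply: (measurable_fun_pair measurable_fst _).
(* For [alpha >= 1], which forces [eta < 0], validity says nothing; but then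
   indistinguishability on the whole space at a good point gives
   [delta + tau >= 1], and without good points [nu >= 1]. *)
have [alpha1|alpha1] := ltP alpha 1%R; last first.
  apply: (@le_trans _ _ 1).
    apply: probability_le1.
    have myU : measurable_fun [set: Omega] (fun w => (y w, U w)).
      exact: measurable_fun_pair.
    by have := myU measurableT C mC; rewrite setTI.
  have [[x Gx]|/set0P/negP/negPn/eqP G0] := pselect (G !=set0).
    have /(_ _ measurableT) := Gx.
    rewrite !preimage_setT !probability_setT mule1 -EFinD lee_fin => et.
    have nu0 : (0 <= nu)%R.
      have := le_trans nuG (probability_le1 _ mG); rewrite lee_fin; lra.
    have : (expR eta <= delta)%R.
      by rewrite -[leLHS]mul1r -ler_pdivlMr ?expR_gt0// -expRN.
    rewrite lee_fin; lra.
  move: nuG; rewrite -/G G0 measure0 !lee_fin; lra.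
rewrite -[X in P X]/[set w | C (y w, U w)] independent_rv_pair//.
apply: le_trans (product_measure_le_xsection (m0 := distribution P0 A0)
  mC mB mG (expR_ge0 eta) tau_ge0 _ nuG) _.
  move=> x Gx.
  have mBx : measurable (xsection B x) by exact: measurable_xsection.
  exact: Gx _ mBx.
rewrite !EFinD leeD2r// leeD2r//.
(* The level [alpha] is tuned so that the factor [expR eta] lost to stability restores exactly
   [delta]. *)
rewrite (_ : delta%:E = (expR eta)%:E * alpha%:E); last first.
  by rewrite -EFinM /alpha mulrCA -expRD subrr expR0 mulr1.
rewrite lee_pmul2l// ?lte_fin ?expR_gt0//.
apply: product_measure_le_ysection => // S.
(* The y-section of [B] at [S] is the miss event of the fixed selection [S], to which validity
   applies as [0 < alpha < 1]. *)
rewrite [X in X <= _](_ : _ = P [set w | ~ CI S alpha (y w) (beta S)]).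
  by apply: CI_valid; rewrite alpha1 mulr_gt0// expR_gt0.
by congr (P _); apply/seteqP; split=> w; rewrite /preimage /= ysectionE.
Qed.
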